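(* Let $G$ be a forest. Then the $\gamma$-polynomial of $h^*(\mathcal{B}_G,x)$ coincides with the $f$-polynomial of a flag simplicial complex.
   Context: For a graph $G$ on $[n]$, the symmetric edge polytope of type B is $\mathcal{B}_G=\mathrm{conv}(\{\pm\mathbf{e}_i: i\in[n]\}\cup\{\pm\mathbf{e}_i\pm\mathbf{e}_j:\{i,j\}\in E(G)\})\subset\mathbb{R}^n$. For a lattice polytope $\mathcal{P}\subset\mathbb{R}^n$ of dimension $d$, $h^*(\mathcal{P},x)$ is defined by $1+\sum_{t\ge1}|t\mathcal{P}\cap\mathbb{Z}^n|x^t = h^*(\mathcal{P},x)/(1-x)^{d+1}$. For bipartite $G$ (in particular a forest), $\mathcal{B}_G$ is reflexive of dimension $n$, so $h^*(\mathcal{B}_G,x)$ is palindromic of degree $n$ and uniquely written as $\sum_i\gamma_ix^i(1+x)^{n-2i}$; its $\gamma$-polynomial is $\sum_i\gamma_ix^i$. A simplicial complex is flag if all its minimal non-faces have exactly two elements; its $f$-polynomial is $\sum_{F\in\Delta}x^{|F|}$ (the empty face contributes $1$). *)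

(* Defs.v *)
From HB Require Import structures.
From mathcomp Require Import all_boot all_order all_algebra finmap.
From mathcomp Require Import boolp classical_sets cardinality reals convex.

Set Implicit Arguments.
Unset Strict Implicit.
Unset Printing Implicit Defensive.

Import Order.TTheory GRing.Theory Num.Theory.

Local Open Scope classical_set_scope.
Local Open Scope ring_scope.

(* [ucycle e c] also holds for the empty sequence and for c = [:: x; y] with
   e x y, whence the condition on the length. *)
Definition forest (V : finType) (e : rel V) : Prop :=
  forall c : seq V, (2 < size c)%N -> ~ ucycle e c.

Section LatticePolytopes.
Variables (R : realType) (n : nat).
Implicit Types P S : set 'rV[R]_n.

Definition convex_hull S : set 'rV[R]_n :=
  smallest [set C : set 'rV[R]_n | convex_set C] S.

(* The maximal number of affinely independent points of P, i.e. dim P + 1, with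
   the value 0 (dimension -1) for the empty set. The rows of M are affinely
   independent iff they become linearly independent after prepending a
   coordinate equal to 1. *)
Definition dim_succ P : nat :=
  \max_(k < n.+2 | `[< exists M : 'M[R]_(k, n),
      (forall i, P (row i M)) /\ row_free (row_mx (const_mx 1 : 'cV_k) M) >]) k.

Definition lattice_points P (t : nat) : set 'rV[int]_n :=
  [set z | exists2 p, P p & map_mx intr z = t%:R *: p].

(* [fset_set A] is only meaningful for A finite, which is the case for the
   lattice points of a bounded set. *)
Definition ehrhart P (t : nat) : nat := #|` fset_set (lattice_points P t)|.

Definition ehrhart_series P (t : nat) : nat :=
  if t is 0%N then 1%N else ehrhart P t.

(* The identity h = (1 - x)^(dim P + 1) * \sum_t ehrhart_series P t * x^t of
   formal power series, read off coefficientwise; it determines h. *)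
Definition hstar_poly P (h : {poly int}) : Prop :=
  forall m : nat, h`_m =
    \sum_(k < m.+1)
      ((1 - 'X) ^+ dim_succ P : {poly int})`_k * (ehrhart_series P (m - k)%N)%:Z.

End LatticePolytopes.

Definition polytopeB (R : realType) (n : nat) (e : rel 'I_n) : set 'rV[R]_n :=
  convex_hull
    ([set v | exists (s : bool) (i : 'I_n), v = (-1) ^+ s *: delta_mx 0 i] `|`
     [set v | exists (s s' : bool) (i j : 'I_n), e i j /\
        v = (-1) ^+ s *: delta_mx 0 i + (-1) ^+ s' *: delta_mx 0 j]).
Arguments polytopeB R [n] e.

(* g is determined by h and n: the polynomials x^i (1 + x)^(n - 2i), for
   2i <= n, are linearly independent. *)
Definition gamma_poly (n : nat) (h g : {poly int}) : Prop :=
  (size g <= n./2.+1)%N /\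
  h = \sum_(i < n./2.+1) g`_i *: ('X^i * (1 + 'X) ^+ (n - i.*2)).

Definition simplicial_complex (V : finType) (D : {set {set V}}) : Prop :=
  finset.set0 \in D /\
  forall F F' : {set V}, F \in D -> F' \subset F -> F' \in D.

Definition flag (V : finType) (D : {set {set V}}) : Prop :=
  forall F : {set V}, minset [pred F' | F' \notin D] F -> #|F| = 2%N.

Definition f_poly (V : finType) (D : {set {set V}}) : {poly int} :=
  \sum_(F in D) 'X^#|F|.

(* Main.v *)
Require Import Defs.
From mathcomp Require Import boolp classical_sets cardinality interval_inference convex.
From mathcomp Require Import all_boot all_order all_algebra finmap.
From mathcomp Require Import reals ring zify.

(** For a bipartite graph the fractional stable set polytope is integral, so by
    duality a lattice point [z] lies in [t B_G] iff every stable set [S] satisfies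
    [\sum_(i in S) |z_i| <= t]. For a forest this is seen directly by removing a
    leaf [v] with neighbour [u]: the maximal weight [N_G(z)] of a stable set equals
    [|z_v| + N_(G - v)(z')], where [z'] is [z] with [|z_u|] lowered to
    [max(|z_u| - |z_v|, 0)]. Summing over [z_v] and [z_u], the Ehrhart series [L_G]
    satisfies
      [L_G = (1 + x) / (1 - x) L_(G - v) + 4 x / (1 - x)^2 L_(G - u - v)],
    so [h*_G = (1 + x) h*_(G - v) + 4 x h*_(G - u - v)]. The polynomial
    [\sum_k 4^k m_k x^k (1 + x)^(n - 2k)], with [m_k] the number of [k]-matchings,
    satisfies the same recursion. Hence the gamma-polynomial is [\sum_k m_k (4 x)^k],
    the f-polynomial of the flag complex of matchings in the multigraph obtained
    from [G] by taking four copies of each edge. *)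

Set Implicit Arguments.
Unset Strict Implicit.
Unset Printing Implicit Defensive.

Import Order.TTheory GRing.Theory Num.Theory.

(** * Forests and stable sets *)

(** Otherwise each vertex of [A] has two neighbours in [A], so a simple path can always be
    prolonged, a repeated vertex closing a cycle. A simple path with more than [#|V|] vertices is
    absurd. *)
Lemma forest_leaf (V : finType) (e : rel V) (A : {set V}) :
  symmetric e -> irreflexive e -> forest e -> A != set0 ->
  exists2 v, v \in A & #|[set u in A | e v u]| <= 1.
Proof.
move=> e_sym e_irr e_for /set0Pn[v0 v0A].
have [/exists_inP[v vA Hv]|/exists_inPn leafless] :=
  boolP [exists v in A, #|[set u in A | e v u]| <= 1]; first by exists v.
have other x y : x \in A -> exists w, [/\ w \in A, e x w & w != y].
  move=> /leafless; rewrite -ltnNge (cardsD1 y) => H.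
  have /card_gt0P[w] : 0 < #|[set u in A | e x u] :\ y| by case: (_ \in _) H; lia.
  by rewrite !inE => /and3P[wy wA xw]; exists w.
have long k : exists x s,
    [/\ path e x s, uniq (x :: s), all [in A] (x :: s) & size s = k].
  elim: k => [|k [x [s [es us As <-]]]].
    by exists v0, [::]; rewrite /= v0A.
  have xA : x \in A by case/andP: As.
  (* The path grows at its head [x]; [w] avoids the vertex following [x], if there is one. *)
  have [w [wA xw wy]] := other x (head x s) xA.
  have wx : w != x by apply: contraTneq xw => ->; rewrite e_irr.
  have [ws|ws] := boolP (w \in x :: s); last first.
    exists w, (x :: s); split=> //=; first by rewrite e_sym xw.
      by rewrite ws.
    by rewrite wA.
  (* The path up to [w] is a cycle, with at least three vertices because [w] is not the head of
     [s]. *)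
  case: (e_for (x :: rcons (take (index w s) s) w)).
    rewrite /= size_rcons size_takel ?index_size //.
    case: s wy ws {es us As xA} => [|y s] /= wy; first by rewrite inE (negPf wx).
    by rewrite [y == w]eq_sym (negPf wy).
  rewrite inE (negPf wx) /= in ws.
  have: path e x (rcons (take (index w s) s) w) /\
        uniq (x :: rcons (take (index w s) s) w).
    have -> : rcons (take (index w s) s) w = take (index w s).+1 s.
      by rewrite (take_nth w) ?index_mem // nth_index.
    split; first exact: take_path.
    by have := take_uniq (index w s).+2 us.
  case=> pe pu; apply/andP; split=> //.
  by rewrite /= rcons_path pe last_rcons e_sym.
have [x [s [_ us _ ss]]] := long #|V|.
by have := max_card [in x :: s]; rewrite (card_uniqP us) /= ss ltnn.
Qed.

Lemma forest_leaf_or_isolated (V : finType) (e : rel V) (A : {set V}) :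
  symmetric e -> irreflexive e -> forest e -> A != set0 ->
  exists2 v, v \in A & {in A, forall w, ~~ e v w} \/
    exists u, [/\ u \in A, e v u & {in A, forall w, e v w -> w = u}].
Proof.
move=> e_sym e_irr e_for A0; have [v vA deg_v] := forest_leaf e_sym e_irr e_for A0.
exists v => //; move: deg_v; rewrite leq_eqVlt ltnS leqn0.
case/orP => [/cards1P[u leaf]|]; [right; exists u|rewrite cards_eq0 => /eqP iso; left].
  have /andP[uA vu] : (u \in A) && e v u.
    by move/setP/(_ u): leaf; rewrite !inE eqxx.
  by split=> // w wA vw; move/setP/(_ w): leaf; rewrite !inE wA vw => /esym/eqP.
by move=> w wA; apply/negP => vw; have := in_set0 w; rewrite -iso inE wA vw.
Qed.

Section StableWeight.
Variables (V : finType) (e : rel V).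
Hypotheses (e_sym : symmetric e) (e_irr : irreflexive e).
Implicit Types (A S : {set V}) (f : V -> nat) (u v : V) (t : nat).

Definition stable S := [forall x in S, forall y in S, ~~ e x y].

Lemma stableP S :
  reflect {in S &, forall x y, ~~ e x y} (stable S).
Proof.
apply: (iffP forall_inP) => [H x y xS yS|H x xS].
  exact: (forall_inP (H x xS)).
by apply/forall_inP => y yS; apply: H.
Qed.

Lemma stableS S S' : S \subset S' -> stable S' -> stable S.
Proof. by move=> /subsetP sS /stableP H; apply/stableP => x y /sS xS /sS; apply: H. Qed.

Lemma stable1 v : stable [set v].
Proof. by apply/stableP => x y /set1P-> /set1P->; rewrite e_irr. Qed.

(** Stands for [N_A(f) <= t], with [N_A(f)] the maximal weight of a stable subset of [A]; the
    maximum itself is never formed. *)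
Definition stable_le A f t :=
  [forall S : {set V}, (S \subset A) && stable S ==> (\sum_(i in S) f i <= t)].

Lemma stable_leP A f t :
  reflect (forall S, S \subset A -> stable S -> \sum_(i in S) f i <= t)
    (stable_le A f t).
Proof.
apply: (iffP forallP) => [H S SA sS|H S].
  by have /implyP := H S; apply; rewrite SA.
by apply/implyP => /andP[]; apply: H.
Qed.

Lemma eq_stable_le A f g t :
  {in A, f =1 g} -> stable_le A f t = stable_le A g t.
Proof.
move=> fg; apply: eq_forallb => S; apply: implyb_id2l => /andP[/subsetP SA _].
by congr (_ <= _); apply: eq_bigr => i /SA/fg.
Qed.

Lemma stable_le_set0 f t : stable_le set0 f t.
Proof. by apply/stable_leP => S; rewrite subset0 => /eqP-> _; rewrite big_set0. Qed.

Lemma stable_le_sub A (B : {set V}) f t :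
  A \subset B -> stable_le B f t -> stable_le A f t.
Proof.
move=> AB /stable_leP H; apply/stable_leP => S SA; apply: H.
exact: subset_trans AB.
Qed.

Lemma stable_le_point A f t v : v \in A -> stable_le A f t -> f v <= t.
Proof.
move=> vA /stable_leP/(_ [set v]); rewrite sub1set big_set1.
by move/(_ vA (stable1 v)).
Qed.

(** An isolated vertex can join every stable set, so it adds exactly [f v] to the maximal weight.
    The conjunct [f v <= t] guards the truncated subtraction. *)
Lemma stable_le_isolated A f t v : v \in A ->
  {in A, forall w, ~~ e v w} ->
  stable_le A f t = (f v <= t) && stable_le (A :\ v) f (t - f v).
Proof.
move=> vA v_iso; apply/idP/andP => [leA|[vt /stable_leP leA]].
  have vt := stable_le_point vA leA; split=> //.
  apply/stable_leP => S SA sS; have vS : v \notin S.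
    by apply/negP => /(subsetP SA); rewrite setD11.
  have SA' : S \subset A by apply: subset_trans SA (subsetDl _ _).
  have /stable_leP/(_ (v |: S)) := leA.
  rewrite subUset sub1set vA SA' big_setU1 //= => le.
  suff /le : stable (v |: S) by lia.
  apply/stableP => x y /setU1P[->|xS] /setU1P[->|yS].
  - by rewrite e_irr.
  - by apply/v_iso/(subsetP SA').
  - by rewrite e_sym; apply/v_iso/(subsetP SA').
  - exact: (stableP _ sS).
apply/stable_leP => S SA sS; have [vS|vS] := boolP (v \in S).
  rewrite (big_setD1 v) //=.
  have := leA (S :\ v) (setSD _ SA) (stableS (subsetDl _ _) sS); lia.
have : S \subset A :\ v by rewrite subsetD1 SA.
by move/leA/(_ sS); lia.
Qed.

Definition clip f u v : V -> nat := fun w => if w == u then f u - f v else f w.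

Lemma sum_clip f u v S : u \in S -> f v <= f u ->
  \sum_(i in S) f i = f v + \sum_(i in S) clip f u v i.
Proof.
move=> uS vu; rewrite !(big_setD1 u uS) /= {1}/clip eqxx.
rewrite [in RHS](eq_bigr f) => [|i /setD1P[/negPf iu _]]; last by rewrite /clip iu.
lia.
Qed.

Lemma sum_clipN f u v S : u \notin S -> \sum_(i in S) clip f u v i = \sum_(i in S) f i.
Proof.
by move=> uS; apply: eq_bigr => i iS; rewrite /clip; case: eqP iS uS => // -> ->.
Qed.

(* Exchange argument: a stable set not containing the leaf [v] either contains
   its neighbour [u] or can be enlarged by [v]. *)
Lemma stable_le_leaf A f t u v : v \in A -> u \in A -> e v u ->
  {in A, forall w, e v w -> w = u} ->
  stable_le A f t = (f v <= t) && stable_le (A :\ v) (clip f u v) (t - f v).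
Proof.
move=> vA uA vu v_leaf.
have uv : u != v by apply: contraTneq vu => ->; rewrite e_irr.
apply/idP/andP => [leA|[vt /stable_leP leA]].
  have vt := stable_le_point vA leA; split=> //.
  apply/stable_leP => S SA sS; have vS : v \notin S.
    by apply/negP => /(subsetP SA); rewrite setD11.
  have SA' : S \subset A by apply: subset_trans SA (subsetDl _ _).
  (* A stable set avoiding [u] stays stable when [v] is added. *)
  have add_v S0 : S0 \subset S -> u \notin S0 -> f v + \sum_(i in S0) f i <= t.
    move=> S0S uS0; have vS0 : v \notin S0 by apply: contra vS; apply: (subsetP S0S).
    have /stable_leP/(_ (v |: S0)) := leA.
    rewrite subUset sub1set vA (subset_trans S0S SA') big_setU1 //=; apply=> //.
    have nbr y : y \in S0 -> ~~ e v y.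
      move=> yS0; apply/negP => /v_leaf yu; move: uS0.
      by rewrite -(yu _) ?yS0 // (subsetP SA') // (subsetP S0S).
    apply/stableP => x y /setU1P[->|xS] /setU1P[->|yS].
    - by rewrite e_irr.
    - exact: nbr.
    - by rewrite e_sym; apply: nbr.
    - exact: (stableP _ (stableS S0S sS)).
  have [uS|uS] := boolP (u \in S); last by rewrite sum_clipN //; have := add_v S (subxx _) uS; lia.
  have [le_vu|lt_uv] := leqP (f v) (f u).
    have /stable_leP/(_ S SA' sS) := leA; rewrite (sum_clip uS le_vu); lia.
  (* Here [f u < f v]: the clipped weight of [u] is 0, and [v] can replace [u] in [S]. *)
  rewrite (big_setD1 u) //= {1}/clip eqxx sum_clipN ?setD11 //.
  have := add_v _ (subsetDl S [set u]) (negbT (setD11 u S)); lia.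
apply/stable_leP => S SA sS; have [vS|vS] := boolP (v \in S).
  have uS : u \notin S by apply/negP => uS; move: (stableP _ sS _ _ vS uS); rewrite vu.
  have := leA (S :\ v) (setSD _ SA) (stableS (subsetDl _ _) sS).
  rewrite sum_clipN; last by apply: contra uS => /setD1P[].
  rewrite (big_setD1 v vS) /=; lia.
(* Undoing the clipping at [u] costs at most [f v]. *)
have : S \subset A :\ v by rewrite subsetD1 SA.
move/leA/(_ sS); have [uS|uS] := boolP (u \in S); last by rewrite sum_clipN //; lia.
rewrite !(big_setD1 u uS) /= {1}/clip eqxx sum_clipN ?setD11 //; lia.
Qed.

End StableWeight.

(** * Counting lattice points *)

Definition update (V : finType) (f : V -> nat) v a : V -> nat :=
  fun w => if w == v then a else f w.

Lemma update_at (V : finType) (f : V -> nat) v a : update f v a v = a.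
Proof. by rewrite /update eqxx. Qed.

Lemma clip_update (V : finType) (f : V -> nat) u v c b : u != v ->
  clip (update (update f u b) v c) u v =
  update (update f u (b - c)) v c.
Proof.
move=> uv; apply: funext => w; rewrite /clip /update eqxx (negPf uv) eqxx.
by have [->|//] := eqVneq w u; rewrite (negPf uv).
Qed.

(** A finite type for the integers from [-M] to [M], split like [Posz] and [Negz], so that points of
    a box are counted by a finite sum. *)
Definition bounded_int (M : nat) := ('I_M.+1 + 'I_M)%type.

Definition int_of_bounded M (a : bounded_int M) : int :=
  match a with inl c => Posz c | inr c => Negz c end.

Definition bounded_abs M (a : bounded_int M) : nat := `|int_of_bounded a|%N.

Lemma int_of_bounded_inj M : injective (@int_of_bounded M).
Proof. by move=> [a|a] [b|b] //= [] /ord_inj->. Qed.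

Lemma bounded_intP M (z : int) : (`|z| <= M)%N ->
  exists a : bounded_int M, int_of_bounded a = z.
Proof.
case: z => k /= kM; first by exists (inl (Ordinal (kM : k < M.+1))).
by exists (inr (Ordinal (kM : k < M))).
Qed.

(** The weight [(c != 0).+1] counts the integers of absolute value [c]: one for 0, two otherwise. *)
Lemma sum_bounded_abs M (F : nat -> nat) :
  \sum_(a : bounded_int M) F (bounded_abs a) =
  \sum_(c < M.+1) (c != 0 :> nat).+1 * F c.
Proof.
rewrite big_sumType /= /bounded_abs /= !big_ord_recl /= mul1n -addnA; congr (_ + _).
by rewrite -big_split /=; apply: eq_bigr => c _; rewrite mul2n -addnn.
Qed.

(* [q] vanishes beyond [s], so shifting the summation index by [c] loses
   nothing and only repeats the value [q 0]. *)
Lemma sum_shift_weight M (q : nat -> nat) c s :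
  (forall b, s < b -> q b = 0) -> s + c <= M ->
  \sum_(b < M.+1) (b != 0 :> nat).+1 * q (b - c) =
  2 * c * q 0 + \sum_(b < M.+1) (b != 0 :> nat).+1 * q b.
Proof.
move=> q0; elim: c => [|c IH] scM.
  by rewrite muln0 mul0n; apply: eq_bigr => b _; rewrite subn0.
have {}IH := IH ltac:(lia); rewrite mulnS mulnDl -addnA -{}IH.
rewrite !big_ord_recl /= !sub0n !mul1n.
rewrite !(eq_bigr _ (fun i _ => erefl : 2 * _ = 2 * _)) -!big_distrr /=.
(* The sum of [q (i - c)] over [i <= M], split off once at its last and once at its first term; the
   last term vanishes as [s < M - c]. *)
have : \sum_(i < M) q (bump 0 i - c.+1) + q (M - c) =
       q 0 + \sum_(i < M) q (bump 0 i - c).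
  transitivity (\sum_(i < M.+1) q (i - c)); first by rewrite big_ord_recr.
  by rewrite big_ord_recl sub0n.
rewrite (q0 (M - c)) ?addn0 => [->|]; last by lia.
by rewrite mulnDr addnCA.
Qed.

Section LatticeCount.
Variables (V : finType) (M : nat).
Implicit Types (A : {set V}) (F : (V -> nat) -> nat).

(** Coordinates outside [A] are frozen at 0, so that deleting vertices keeps the type of points
    unchanged. *)
Definition sum_on A F : nat :=
  \sum_(z : {ffun V -> bounded_int M}
          | [forall w, (w \notin A) ==> (z w == inl ord0)])
     F (fun w => bounded_abs (z w)).

Lemma eq_sum_on A F F' : (forall f, F f = F' f) -> sum_on A F = sum_on A F'.
Proof. by move=> FF; apply: eq_bigr. Qed.

Lemma sum_on0 F : sum_on set0 F = F (fun=> 0).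
Proof.
rewrite /sum_on (big_pred1 [ffun=> inl ord0]) => [|z].
  by congr F; apply: funext => w; rewrite ffunE.
apply/forallP/eqP => [H|-> w]; last by rewrite ffunE eqxx implybT.
by apply/ffunP => w; rewrite ffunE; apply/eqP; have := H w; rewrite inE.
Qed.

Lemma sum_on_D1 A F v : v \in A ->
  sum_on A F = \sum_(c < M.+1) (c != 0 :> nat).+1 *
                 sum_on (A :\ v) (fun f => F (update f v c)).
Proof.
move=> vA.
rewrite -(sum_bounded_abs _ (fun c => sum_on (A :\ v) (fun f => F (update f v c)))).
rewrite {1}/sum_on (partition_big (fun z : {ffun V -> bounded_int M} => z v) predT) //=.
apply: eq_bigr => a _; rewrite /sum_on.
pose upd (b : bounded_int M) (z : {ffun V -> bounded_int M}) :=
  [ffun w => if w == v then b else z w].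
(* Points with value [a] at [v] correspond to points with value 0 there. *)
rewrite (reindex_onto (upd a) (upd (inl ord0))); last first.
  by move=> z /andP[_ /eqP <-]; apply/ffunP => w; rewrite !ffunE; case: eqP => [->|].
apply: eq_big => [z|z _]; last first.
  by congr F; apply: funext => w; rewrite /update ffunE; case: ifP.
rewrite ffunE eqxx eqxx andbT.
apply/andP/forallP => [[/forallP H /eqP <-] w|H].
  rewrite !ffunE in_setD1; have := H w; rewrite ffunE.
  by case: (w == v).
split.
  apply/forallP => w; have := H w; rewrite ffunE in_setD1.
  by case: eqP => [->|]; rewrite ?vA.
apply/eqP/ffunP => w; rewrite !ffunE; case: eqP => // ->.
by have := H v; rewrite in_setD1 eqxx => /eqP ->.
Qed.

Lemma sum_on_mull A F k : sum_on A (fun f => k * F f) = k * sum_on A F.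
Proof. by rewrite /sum_on big_distrr. Qed.

Lemma sum_on_eq0 A F : (forall f, F f = 0) -> sum_on A F = 0.
Proof. by move=> F0; apply: big1 => z _. Qed.

Variables (e : rel V).
Hypotheses (e_sym : symmetric e) (e_irr : irreflexive e).

(** For [t <= M] the box is no restriction: singletons are stable, so each coordinate is at most [t]
    in absolute value. *)
Definition stable_count A t : nat := sum_on A (fun f => stable_le e A f t).

Lemma stable_count_set0 t : stable_count set0 t = 1.
Proof. by rewrite /stable_count sum_on0 stable_le_set0. Qed.

Lemma stable_count0 A : stable_count A 0 = 1.
Proof.
rewrite /stable_count /sum_on (bigD1 [ffun=> inl ord0]) /=; last first.
  by apply/forallP => w; rewrite ffunE eqxx implybT.
rewrite big1 ?addn0 => [|z /andP[/forallP zA z0]].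
  suff -> : stable_le e A (fun w => bounded_abs ([ffun=> inl ord0 : bounded_int M] w)) 0.
    by [].
  apply/stable_leP => S _ _; rewrite big1 // => i _; by rewrite ffunE.
apply/eqP; rewrite eqb0; apply: contra z0 => le0.
apply/eqP/ffunP => w; rewrite ffunE; apply: int_of_bounded_inj => /=.
have [wA|wA] := boolP (w \in A); last first.
  by have := zA w; rewrite wA => /eqP->.
have := stable_le_point e_irr wA le0.
by rewrite leqn0 absz_eq0 => /eqP.
Qed.

Lemma stable_le_update A f v c t :
  stable_le e (A :\ v) (update f v c) t = stable_le e (A :\ v) f t.
Proof. by apply: eq_stable_le => w /setD1P[/negPf wv _]; rewrite /update wv. Qed.

Lemma sum_weight_cond (G : nat -> nat -> nat) t : t <= M ->
  \sum_(c < M.+1) (c != 0 :> nat).+1 * ((c <= t) * G c (t - c)) =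
  \sum_(c < t.+1) (c != 0 :> nat).+1 * G c (t - c).
Proof.
move=> tM; rewrite (big_ord_widen M.+1 (fun c => (c != 0).+1 * G c (t - c))) //.
rewrite [RHS]big_mkcond; apply: eq_bigr => c _; rewrite ltnS.
by case: (c <= t); rewrite ?mul1n ?mul0n ?muln0.
Qed.

(** A convolution with 1, 2, 2, ..., the coefficients of [(1 + x) / (1 - x)]. *)
Lemma stable_count_isolated A t v : t <= M -> v \in A ->
  {in A, forall w, ~~ e v w} ->
  stable_count A t =
  \sum_(c < t.+1) (c != 0 :> nat).+1 * stable_count (A :\ v) (t - c).
Proof.
move=> tM vA v_iso; rewrite {1}/stable_count (sum_on_D1 _ vA).
rewrite -(sum_weight_cond (fun=> stable_count (A :\ v)) tM).
apply: eq_bigr => c _; congr (_ * _); rewrite -sum_on_mull; apply: eq_sum_on => f.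
rewrite (stable_le_isolated e_sym e_irr _ _ vA v_iso) update_at.
by rewrite stable_le_update mulnb.
Qed.

(** With [c = |z_v|], clipping shifts [|z_u|] by [c], which by [sum_shift_weight] yields [2 * c]
    extra points with [z_u = 0] for each point on [A :\ v :\ u]. The signs of [z_v] double this to
    [4 * c], a coefficient of [4 x / (1 - x)^2]. *)
Lemma stable_count_leaf A t u v : t <= M -> v \in A -> u \in A -> e v u ->
  {in A, forall w, e v w -> w = u} ->
  stable_count A t =
  \sum_(c < t.+1) ((c != 0 :> nat).+1 * stable_count (A :\ v) (t - c) +
                   4 * c * stable_count (A :\ v :\ u) (t - c)).
Proof.
move=> tM vA uA vu v_leaf.
have uv : u != v by apply: contraTneq vu => ->; rewrite e_irr.
have uAv : u \in A :\ v by rewrite in_setD1 uv.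
(* The count on [A :\ v] with the coordinate at [u] fixed to absolute value [b]. *)
pose Q b s := sum_on (A :\ v :\ u) (fun f => stable_le e (A :\ v) (update f u b) s).
have Q0 s : Q 0 s = stable_count (A :\ v :\ u) s.
  apply: eq_sum_on => f; congr nat_of_bool; rewrite -(stable_le_update _ f u 0).
  apply/idP/idP; first exact/stable_le_sub/subsetDl.
  move=> /stable_leP H; apply/stable_leP => S SA sS.
  have := H (S :\ u) (setSD _ SA) (stableS (subsetDl _ _) sS).
  have [uS|uS] := boolP (u \in S); last first.
    by rewrite (_ : S :\ u = S) //; apply/setDidPl; rewrite disjoint_sym disjoints1.
  by rewrite (big_setD1 u uS) /= {2}/update eqxx add0n.
have Q_vanish s b : s < b -> Q b s = 0.
  move=> sb; apply: sum_on_eq0 => f; apply/eqP; rewrite eqb0; apply/negP.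
  by move/(stable_le_point e_irr uAv); rewrite /update eqxx; lia.
have countE s : stable_count (A :\ v) s = \sum_(b < M.+1) (b != 0 :> nat).+1 * Q b s.
  by rewrite /stable_count (sum_on_D1 _ uAv).
rewrite {1}/stable_count (sum_on_D1 _ vA).
pose G c s := stable_count (A :\ v) s + 2 * c * Q 0 s.
transitivity (\sum_(c < t.+1) (c != 0 :> nat).+1 * G c (t - c)); last first.
  apply: eq_bigr => c _; rewrite /G Q0 mulnDr; congr (_ + _); rewrite mulnA; congr (_ * _).
  by case: (nat_of_ord c) => // k; rewrite mulnA.
rewrite -sum_weight_cond //; apply: eq_bigr => c _; congr (_ * _).
(* Deleting the leaf [v] turns the value [b] at [u] into [b - c]. *)
transitivity ((c <= t) * \sum_(b < M.+1) (b != 0 :> nat).+1 * Q (b - c) (t - c)).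
  rewrite (sum_on_D1 _ uAv) big_distrr /=; apply: eq_bigr => b _.
  rewrite mulnCA /Q -(sum_on_mull _ _ (c <= t)); congr (_ * _); apply: eq_sum_on => f.
  rewrite (stable_le_leaf e_sym e_irr _ _ vA uA vu v_leaf) clip_update //.
  by rewrite update_at stable_le_update mulnb.
have [ct|//] := leqP c t; congr (_ * _).
by rewrite (sum_shift_weight (@Q_vanish (t - c))) /G -?countE 1?addnC //; lia.
Qed.

End LatticeCount.

(** * Labelled matchings *)

Local Open Scope ring_scope.

Section LabelledMatchings.
Variables (V : finType) (e : rel V).
Hypotheses (e_sym : symmetric e) (e_irr : irreflexive e).

(* Two orientations and a boolean label: four copies of every edge. *)
Definition edge_copy := {p : V * V * bool | e p.1.1 p.1.2}.

Implicit Types (A : {set V}) (F : {set edge_copy}) (x y : edge_copy).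

Definition ends x : {set V} := [set (val x).1.1; (val x).1.2].

(** Copies of one edge share their ends, so at most one is chosen: each [k]-matching of the graph
    arises [4^k] times. *)
Definition matching F :=
  [forall x in F, forall y in F, (x != y) ==> [disjoint ends x & ends y]].

Definition matching_complex : {set {set edge_copy}} := [set F | matching F].

Definition covered F : {set V} := \bigcup_(x in F) ends x.

Lemma matchingP F :
  reflect {in F &, forall x y, x != y -> [disjoint ends x & ends y]} (matching F).
Proof.
apply: (iffP forall_inP) => [H x y xF yF|H x xF].
  by move/(_ x xF)/forall_inP/(_ y yF)/implyP: H.
by apply/forall_inP => y yF; apply/implyP/H.
Qed.

Lemma matchingS F F' : F \subset F' -> matching F' -> matching F.
Proof.
by move=> /subsetP sF /matchingP H; apply/matchingP => x y /sF xF /sF; apply: H.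
Qed.

Lemma matching_complex_simplicial : simplicial_complex matching_complex.
Proof.
split=> [|F F' /[!inE] mF /matchingS -> //].
by rewrite inE; apply/matchingP => x y; rewrite inE.
Qed.

(** Being a matching is a condition on pairs: a non-matching contains two conflicting copies, which
    by minimality are all of it. *)
Lemma matching_complex_flag : flag matching_complex.
Proof.
move=> F /minsetP[]; rewrite !inE => /matchingP nF minF.
have [x [y [xF yF xy nd]]] : exists x y,
    [/\ x \in F, y \in F, x != y & ~~ [disjoint ends x & ends y]].
  apply: contrapT => none; apply: nF => x y xF yF xy; apply: contrapT => /negP nd.
  by apply: none; exists x, y.
have <- : [set x; y] = F; last by rewrite cards2 xy.
apply: minF; last by rewrite subUset !sub1set xF.
rewrite !inE; apply/negP => /matchingP/(_ x y); rewrite !inE !eqxx orbT => H.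
by move: nd; rewrite H.
Qed.

Lemma covered_setU1 x F : covered (x |: F) = ends x :|: covered F.
Proof. by rewrite /covered bigcup_setU big_set1. Qed.

Lemma ends_sub_covered x F : x \in F -> ends x \subset covered F.
Proof. exact: bigcup_sup. Qed.

Lemma card_ends x : #|ends x| = 2%N.
Proof.
case: x => [[[a b] c] /= ab]; rewrite cards2.
by have -> : a != b by apply: contraTneq ab => ->; rewrite e_irr.
Qed.

Lemma matching_setU1 x F : x \notin F ->
  matching (x |: F) = matching F && [disjoint ends x & covered F].
Proof.
move=> xF; apply/idP/andP => [mxF|[/matchingP mF dx]].
  split; first exact: matchingS (subsetUr _ _) mxF.
  apply/bigcup_disjointP => y yF.
  apply: (matchingP _ mxF); rewrite ?setU11 ?setU1r //.
  by apply: contraNneq xF => ->.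
have dxy y : y \in F -> [disjoint ends x & ends y].
  by move=> /ends_sub_covered yF; rewrite disjoint_sym (disjointWl yF) // disjoint_sym.
apply/matchingP => y z /setU1P[->|yF] /setU1P[->|zF] yz; rewrite ?eqxx // in yz *.
- exact: dxy.
- by rewrite disjoint_sym dxy.
- exact: mF.
Qed.

Lemma card_covered F : matching F -> #|covered F| = (#|F|.*2)%N.
Proof.
have [m] := ubnP #|F|; elim: m F => // m IH F.
have [->|/set0Pn[x xF]] := eqVneq F set0.
  by rewrite /covered big_set0 !cards0.
rewrite -(setD1K xF) covered_setU1 matching_setU1 ?setD11 // cardsU1 setD11 /=.
rewrite add1n ltnS => Fm /andP[mF dF]; rewrite cardsU (IH _ Fm mF) card_ends.
by move: dF; rewrite -setI_eq0 => /eqP->; rewrite cards0 subn0 doubleS.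
Qed.

(** The exponent of [1 + 'X] is [#|A| - 2 #|F|]; written as the number of uncovered vertices, it
    behaves well under vertex deletion. *)
Definition matching_poly A : {poly int} :=
  \sum_(F | matching F && (covered F \subset A))
     'X^#|F| * (1 + 'X) ^+ #|A :\: covered F|.

Lemma matching_poly_set0 : matching_poly set0 = 1.
Proof.
rewrite /matching_poly (big_pred1 set0) => [|F /=].
  by rewrite cards0 set0D cards0 !expr0 mulr1.
rewrite subset0; apply/andP/eqP => [[_ cF]|->]; last first.
  split; first by apply/matchingP => x y; rewrite inE.
  by rewrite /covered big_set0.
apply/setP => x; rewrite inE; apply/negP => /ends_sub_covered.
by rewrite (eqP cF) subset0 -cards_eq0 card_ends.
Qed.

(** Either [F] leaves [v] uncovered, or it contains a unique edge copy [x] at [v], and [F :\ x] is a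
    matching avoiding the ends of [x]. *)
Lemma matching_poly_rec A v : v \in A ->
  matching_poly A = (1 + 'X) * matching_poly (A :\ v) +
    \sum_(x | (v \in ends x) && (ends x \subset A)) 'X * matching_poly (A :\: ends x).
Proof.
move=> vA; rewrite {1}/matching_poly (bigID (fun F => v \notin covered F)) /=.
congr (_ + _).
  rewrite [in RHS]/matching_poly big_distrr /=; apply: eq_big => [F|F /andP[_ vF]].
    by rewrite subsetD1 andbA.
  rewrite (cardsD1 v (A :\: _)) inE vF vA /= add1n exprS.
  by rewrite !setDDl [covered F :|: _]setUC mulrCA.
pose term F : {poly int} := 'X^#|F| * (1 + 'X) ^+ #|A :\: covered F|.
(* The inner sum has exactly one term, the edge copy covering [v]. *)
transitivity (\sum_(F | matching F && (covered F \subset A) && ~~ (v \notin covered F))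
   \sum_(x | (x \in F) && (v \in ends x)) term F).
  apply: eq_bigr => F /andP[/andP[/matchingP mF _]]; rewrite negbK => /bigcupP[x xF vx].
  rewrite (big_pred1 x) // => y; apply/andP/eqP => [[yF vy]|->//].
  apply/eqP; apply/negPn/negP => /(mF _ _ yF xF) /pred0P/(_ v).
  by rewrite /= vy vx.
rewrite (exchange_big_dep (fun x => (v \in ends x) && (ends x \subset A))) /=; last first.
  move=> F x /andP[/andP[_ FA] _] /andP[xF ->] /=.
  exact: subset_trans (ends_sub_covered xF) FA.
apply: eq_bigr => x /andP[vx xA]; rewrite /matching_poly big_distrr /=.
rewrite (reindex_onto (fun F => x |: F) (fun F => F :\ x)) /=; last first.
  by move=> F /andP[_ /andP[xF _]]; rewrite setD1K.
have xE F : ((x |: F) :\ x == F) = (x \notin F).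
  apply/eqP/idP => [<-|xF]; first by rewrite setD11.
  by rewrite setU1K.
apply: eq_big => [F|F]; rewrite xE.
  have vxF : v \in covered (x |: F) by rewrite covered_setU1 inE vx.
  rewrite vxF vx setU11 /= !andbT subsetD (andbC (covered F \subset A)).
  apply/idP/idP => [/andP[/andP[mF cF] xF]|/andP[mF /andP[dF cF]]].
    move: mF cF; rewrite matching_setU1 // covered_setU1 subUset => /andP[-> dF].
    by rewrite disjoint_sym dF => /andP[_ ->].
  have xF : x \notin F.
    apply/negP => /ends_sub_covered /subsetP/(_ v vx) vF.
    by move/pred0P/(_ v): dF; rewrite /= vF vx.
  by rewrite matching_setU1 // mF disjoint_sym dF covered_setU1 subUset xA cF.
move=> /andP[_ xF].
by rewrite /term covered_setU1 -setDDl cardsU1 xF add1n exprS mulrA.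
Qed.

Lemma matching_poly_isolated A v : v \in A -> {in A, forall w, ~~ e v w} ->
  matching_poly A = (1 + 'X) * matching_poly (A :\ v).
Proof.
move=> vA v_iso; rewrite (matching_poly_rec vA) big_pred0 ?addr0 // => x.
apply/negP; case: x => [[[a b] c] /= ab] /andP[].
rewrite /ends /= subUset !sub1set => /set2P[] va /andP[aA bA].
  by have := v_iso b bA; rewrite va ab.
by have := v_iso a aA; rewrite va e_sym ab.
Qed.

Lemma matching_poly_leaf A u v : v \in A -> u \in A -> e v u ->
  {in A, forall w, e v w -> w = u} ->
  matching_poly A =
  (1 + 'X) * matching_poly (A :\ v) + 'X * matching_poly (A :\ v :\ u) *+ 4.
Proof.
move=> vA uA vu v_leaf; rewrite (matching_poly_rec vA); congr (_ + _).
have uv : e u v by rewrite e_sym.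
have neq_uv : (u == v) = false by apply: contraTF vu => /eqP ->; rewrite e_irr.
(* The four copies of the only edge at [v] inside [A]. *)
pose s : seq edge_copy :=
  [:: exist _ (v, u, true) vu; exist _ (v, u, false) vu;
      exist _ (u, v, true) uv; exist _ (u, v, false) uv].
have s_uniq : uniq s.
  by rewrite /= !inE -!val_eqE /= !xpair_eqE !(eq_sym v u) !neq_uv ?andbF /= ?eqxx.
have sE x : (v \in ends x) && (ends x \subset A) = (x \in s).
  rewrite !inE -!val_eqE /=; case: x => [[[a b] c] /= ab].
  rewrite /ends /= subUset !sub1set !xpair_eqE.
  apply/idP/idP => [/andP[/orP[] /eqP va /andP[aA bA]]|].
  - rewrite -va in ab *; rewrite (v_leaf b bA ab) !eqxx /=.
    by case: c; rewrite ?orbT.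
  - rewrite -va e_sym in ab *; rewrite (v_leaf a aA ab) !eqxx /=.
    by case: c; rewrite ?orbT.
  by case/or4P => /andP[/andP[/eqP-> /eqP->] _]; rewrite vA uA eqxx ?orbT.
rewrite (eq_bigl [in s]) // (eq_bigr (fun=> 'X * matching_poly (A :\ v :\ u))).
  by rewrite sumr_const (card_uniqP s_uniq).
move=> x; rewrite /= !inE => xs; congr (_ * matching_poly _); rewrite setDDl.
by case/or4P: xs => /eqP->; rewrite /ends //= setUC.
Qed.

Lemma size_f_poly_matching : (size (f_poly matching_complex) <= (#|V|)./2.+1)%N.
Proof.
apply: (leq_trans (size_sum _ _ _)); apply/bigmax_leqP => F.
rewrite inE => mF; rewrite size_polyXn ltnS.
by rewrite -[X in (X <= _)%N]doubleK -card_covered // half_leq // max_card.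
Qed.

Lemma matching_poly_gamma :
  gamma_poly #|V| (matching_poly setT) (f_poly matching_complex).
Proof.
split; first exact: size_f_poly_matching.
rewrite /f_poly /matching_poly.
(* After exchanging the sums, each [F] contributes only at [i = #|F|]. *)
under [RHS]eq_bigr => i _ do rewrite coef_sum scaler_suml.
rewrite exchange_big /=; apply: eq_big => [F|F /andP[mF _]].
  by rewrite subsetT andbT inE.
have Fn : (#|F| < (#|V|)./2.+1)%N.
  by rewrite ltnS -[X in (X <= _)%N]doubleK -card_covered // half_leq // max_card.
rewrite (bigD1 (Ordinal Fn)) //= big1 ?addr0 => [|i iF].
  by rewrite coefXn eqxx scale1r cardsD setTI cardsT card_covered.
by rewrite coefXn -val_eqE /= in iF *; rewrite (negPf iF) scale0r.
Qed.

End LabelledMatchings.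

(** * Power series *)

Section TruncatedSeries.
Variable N : nat.
Implicit Types p q r : {poly int}.

(** Congruence modulo ['X^N], which lets polynomials stand in for power series. *)
Definition eq_upto p q := forall k, (k < N)%N -> p`_k = q`_k.

Lemma eq_upto_trans q p r : eq_upto p q -> eq_upto q r -> eq_upto p r.
Proof. by move=> pq qr k kN; rewrite pq ?qr. Qed.

Lemma eq_uptoD p p' q q' : eq_upto p p' -> eq_upto q q' -> eq_upto (p + q) (p' + q').
Proof. by move=> pp qq k kN; rewrite !coefD pp ?qq. Qed.

Lemma eq_uptoM p p' q q' : eq_upto p p' -> eq_upto q q' -> eq_upto (p * q) (p' * q').
Proof.
move=> pp qq k kN; rewrite !coefM; apply: eq_bigr => j _.
by rewrite pp ?qq //; have := ltn_ord j; lia.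
Qed.

Lemma eq_uptoMl r p q : eq_upto p q -> eq_upto (r * p) (r * q).
Proof. exact: eq_uptoM. Qed.

Definition trunc_series (c : nat -> nat) : {poly int} := \poly_(k < N) (c k)%:R.

Lemma coef_trunc_series c k : (k < N)%N -> (trunc_series c)`_k = (c k)%:R.
Proof. by move=> kN; rewrite coef_poly kN. Qed.

Lemma one_subX_trunc_series1 : eq_upto ((1 - 'X) * trunc_series (fun=> 1%N)) 1.
Proof.
move=> k kN; rewrite mulrBl mul1r coefB coefXM coef1 coef_trunc_series //.
by case: k kN => [|k] kN //=; rewrite coef_trunc_series ?subrr // ltnW.
Qed.

Lemma one_subX_trunc_series_weight :
  eq_upto ((1 - 'X) * trunc_series (fun k => (k != 0 :> nat).+1)) (1 + 'X).
Proof.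
move=> k kN; rewrite mulrBl mul1r coefB coefXM coefD coef1 coefX coef_trunc_series //.
case: k kN => [|[|k]] kN //=; rewrite coef_trunc_series ?subrr ?addr0 ?add0r //; exact: ltnW.
Qed.

Lemma one_subX_sqr_trunc_series_id :
  eq_upto ((1 - 'X) ^+ 2 * trunc_series (fun k => 4 * k)%N) ('X *+ 4).
Proof.
(* One factor [1 - 'X] takes differences, leaving [4 x / (1 - x)]. *)
have step : eq_upto ((1 - 'X) * trunc_series (fun k => 4 * k)%N)
                    ('X * trunc_series (fun=> 1%N) *+ 4).
  move=> k kN; rewrite mulrBl mul1r coefB coefMn !coefXM.
  case: k kN => [|k] kN /=; first by rewrite coef_trunc_series // subr0 mul0rn.
  rewrite !coef_trunc_series ?(ltnW kN) //.
  by rewrite -natrB -?mulnBr ?subSnn ?muln1 // leq_mul2l leqnSn.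
rewrite expr2 -mulrA; apply: eq_upto_trans (eq_uptoMl _ step) _.
rewrite mulrnAr mulrCA -[X in eq_upto _ (X *+ 4)]mulr1 -!mulrnAl.
exact/eq_uptoMl/one_subX_trunc_series1.
Qed.

End TruncatedSeries.

Section CountSeries.
Variables (V : finType) (e : rel V) (M : nat).
Hypotheses (e_sym : symmetric e) (e_irr : irreflexive e) (e_forest : forest e).

(** Both sides obey the same recursion under deletion of a leaf or isolated vertex. One factor
    [1 - 'X] clears [(1 + x) / (1 - x)], two clear [4 x / (1 - x)^2]; for [A] empty the series is
    [1 / (1 - x)]. *)
Lemma stable_count_series (A : {set V}) :
  eq_upto M.+1 ((1 - 'X) ^+ #|A|.+1 * trunc_series M.+1 (stable_count M e A))
    (matching_poly e A).
Proof.
have [m] := ubnP #|A|; elim: m A => // m IH A Am.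
have [->|A0] := eqVneq A set0.
  rewrite cards0 matching_poly_set0 // expr1.
  apply: eq_upto_trans (@one_subX_trunc_series1 M.+1); apply: eq_uptoMl => k kM.
  by rewrite !coef_trunc_series // stable_count_set0.
have [v vA deg_v] := forest_leaf_or_isolated e_sym e_irr e_forest A0.
have cA : #|A| = #|A :\ v|.+1 by rewrite (cardsD1 v) vA.
have IHv := IH (A :\ v) ltac:(lia).
case: deg_v => [v_iso|[u [uA vu v_leaf]]].
  rewrite (matching_poly_isolated e_sym vA v_iso).
  apply: (@eq_upto_trans _ ((1 - 'X) ^+ #|A|.+1 *
     (trunc_series M.+1 (fun k => (k != 0 :> nat).+1) *
      trunc_series M.+1 (stable_count M e (A :\ v))))).
    apply: eq_uptoMl => k kM.
    rewrite coef_trunc_series // (stable_count_isolated e_sym e_irr _ vA v_iso) //.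
    rewrite coefM natr_sum; apply: eq_bigr => j _.
    by rewrite !coef_trunc_series ?natrM //; have := ltn_ord j; lia.
  rewrite cA exprS mulrACA.
  exact/eq_uptoM/IHv/one_subX_trunc_series_weight.
have uAv : u \in A :\ v by rewrite !inE uA andbT; apply: contraTneq vu => ->; rewrite e_irr.
have cAv : #|A :\ v| = #|A :\ v :\ u|.+1 by rewrite (cardsD1 u) uAv.
have IHu := IH (A :\ v :\ u) ltac:(lia).
rewrite (matching_poly_leaf e_sym e_irr vA uA vu v_leaf) -mulrnAl.
apply: (@eq_upto_trans _ ((1 - 'X) ^+ #|A|.+1 *
   (trunc_series M.+1 (fun k => (k != 0 :> nat).+1) *
      trunc_series M.+1 (stable_count M e (A :\ v)) +
    trunc_series M.+1 (fun k => 4 * k)%N *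
      trunc_series M.+1 (stable_count M e (A :\ v :\ u))))).
  apply: eq_uptoMl => k kM.
  rewrite coef_trunc_series // (stable_count_leaf e_sym e_irr _ vA uA vu v_leaf) //.
  rewrite coefD !coefM -big_split natr_sum; apply: eq_bigr => j _ /=.
  by rewrite !coef_trunc_series ?natrD ?natrM //; have := ltn_ord j; lia.
rewrite mulrDr; apply: eq_uptoD.
  by rewrite cA exprS mulrACA; apply/eq_uptoM/IHv/one_subX_trunc_series_weight.
rewrite cA cAv -addn2 addnC exprD mulrACA.
exact/eq_uptoM/IHu/one_subX_sqr_trunc_series_id.
Qed.

End CountSeries.

(** * The polytope *)

Lemma conv_lmodE (R : realType) (E : lmodType R) (x y : convex_lmodType E) (l : {i01 R}) :
  conv l x y = l%:num *: (x : E) + (1 - l%:num) *: (y : E).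
Proof. by []. Qed.

Section TypeBPolytope.
Variables (R : realType) (n : nat) (e : rel 'I_n).
Hypotheses (e_sym : symmetric e) (e_irr : irreflexive e).
Implicit Types (p q x y : 'rV[R]_n) (z : 'rV[int]_n) (A S : {set 'I_n}).

Let B := polytopeB R e.

Lemma polytopeB_vertex (s : bool) i : B ((-1) ^+ s *: delta_mx 0 i).
Proof. by move=> C [_]; apply; left; exists s, i. Qed.

Lemma polytopeB_edge (s s' : bool) i j : e i j ->
  B ((-1) ^+ s *: delta_mx 0 i + (-1) ^+ s' *: delta_mx 0 j).
Proof. by move=> ij C [_]; apply; right; exists s, s', i, j. Qed.

Lemma polytopeB_conv a b p q :
  0 <= a -> 0 <= b -> a + b = 1 -> B p -> B q -> B (a *: p + b *: q).
Proof.
move=> a0 b0 ab Bp Bq C CG; have [cC _] := CG.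
have a1 : a <= 1 by rewrite -ab lerDl.
have := cC p q (Itv01 a0 a1) (mem_set (Bp C CG)) (mem_set (Bq C CG)).
by move/set_mem; rewrite conv_lmodE /= -ab addrAC subrr add0r.
Qed.

(** The midpoint of two opposite vertices; [i] excludes [n = 0], where the polytope is empty. *)
Lemma polytopeB0 (i : 'I_n) : B 0.
Proof.
have := @polytopeB_conv 2^-1 2^-1 _ _ _ _ _ (polytopeB_vertex false i) (polytopeB_vertex true i).
rewrite expr0 expr1 scale1r scaleN1r scalerN subrr; apply; rewrite ?invr_ge0 //.
by field.
Qed.

Definition dilate (t : nat) x : Prop := exists2 p, B p & x = t%:R *: p.

Lemma dilate_scale k p : B p -> dilate k (k%:R *: p).
Proof. by exists p. Qed.

Lemma dilateD s t x y : dilate s x -> dilate t y -> dilate (s + t) (x + y).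
Proof.
(* If [s = t = 0] both points vanish; otherwise take the convex combination of [p] and [q] with
   weights proportional to [s] and [t]. *)
move=> [p Bp ->] [q Bq ->]; have [|st0] := eqVneq (s + t)%N 0%N.
  by move=> /eqP; rewrite addn_eq0 => /andP[/eqP-> /eqP->]; exists p; rewrite // !scale0r addr0.
have st_neq0 : (s + t)%:R != 0 :> R by rewrite pnatr_eq0.
exists ((s%:R / (s + t)%:R) *: p + (t%:R / (s + t)%:R) *: q).
  by apply: polytopeB_conv => //; rewrite ?divr_ge0 // -mulrDl -natrD divff.
by rewrite scalerDr !scalerA ![(s + t)%:R * _]mulrC !divfK.
Qed.

(** The inequality defines a convex set, and it holds at the generators because a stable set
    contains at most one end of an edge. *)
Lemma polytopeB_stable_sum p S : B p -> stable e S -> \sum_(i in S) `|p 0 i| <= 1.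
Proof.
move=> Bp sS; pose C := [set q : 'rV[R]_n | \sum_(i in S) `|q 0 i| <= 1]%classic.
have delta_le i : \sum_(j in S) (j == i)%:R = (i \in S)%:R :> R.
  have [iS|iS] := boolP (i \in S).
    rewrite (bigD1 i) //= eqxx big1 ?addr0 // => j /andP[_ /negPf->] //.
  by apply: big1 => j jS; case: eqP => // ji; rewrite -ji jS in iS.
have normE s i j : `|((-1) ^+ s *: delta_mx 0 i : 'rV[R]_n) 0 j| = (j == i)%:R.
  by rewrite !mxE eqxx /= normrM normrX normrN1 expr1n mul1r normr_nat.
apply: (Bp C); split.
  move=> x y l /set_mem Cx /set_mem Cy; apply: mem_set; rewrite /C /= in Cx Cy *.
  have l0 : 0 <= l%:num :> R by [].
  have l1 : 0 <= 1 - l%:num :> R by rewrite subr_ge0.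
  apply: (@le_trans _ _ (\sum_(i in S) (l%:num * `|x 0 i| + (1 - l%:num) * `|y 0 i|))).
    apply: ler_sum => i _; rewrite conv_lmodE !mxE.
    by apply: (le_trans (ler_normD _ _)); rewrite !normrM (ger0_norm l0) (ger0_norm l1).
  rewrite big_split /= -!mulr_sumr.
  have one : l%:num * 1 + (1 - l%:num) * 1 = 1 :> R by rewrite !mulr1 addrC subrK.
  rewrite -[X in _ <= X]one.
  by apply: lerD; apply: ler_wpM2l.
move=> q [[s [i ->]]|[s [s' [i [j [ij ->]]]]]]; rewrite /C /=.
  by under eq_bigr => j _ do rewrite normE; rewrite delta_le lern1 leq_b1.
apply: (@le_trans _ _ (\sum_(k in S) ((k == i)%:R + (k == j)%:R))).
  apply: ler_sum => k _; rewrite [X in `|X|]mxE.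
  by apply: (le_trans (ler_normD _ _)); rewrite !normE.
rewrite big_split /= !delta_le -natrD lern1.
case: (boolP (i \in S)) => [iS|_]; case: (boolP (j \in S)) => [jS|_] //.
by have := stableP _ _ sS _ _ iS jS; rewrite ij.
Qed.

Lemma dilate_stable_le t z :
  dilate t (map_mx intr z) -> stable_le e setT (fun i => absz (z 0 i)) t.
Proof.
move=> [p Bp zp]; apply/stable_leP => S _ sS; rewrite -(ler_nat R) natr_sum.
have zE i : (absz (z 0 i))%:R = t%:R * `|p 0 i|.
  have := congr1 (fun x : 'rV[R]_n => `|x 0 i|) zp; rewrite !mxE normrM normr_nat => <-.
  by rewrite -intr_norm -abszE.
under eq_bigr => i _ do rewrite zE.
rewrite -mulr_sumr -[X in _ <= X]mulr1; apply: ler_wpM2l => //.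
exact: polytopeB_stable_sum.
Qed.

Lemma intr_sign_absz (k : int) : k%:~R = (-1) ^+ (k < 0)%R * (absz k)%:R :> R.
Proof. by rewrite [in LHS](intEsign k) rmorphM rmorph_sign. Qed.

Hypothesis e_forest : forest e.

(** Induction on [A]: splitting off the coordinate at [v] uses up [|z_v|] of the dilation factor,
    and the remainder meets the bound [t - |z_v|]. *)
Lemma stable_le_dilate (i0 : 'I_n) A t z :
  (forall i, i \notin A -> z 0 i = 0) ->
  stable_le e A (fun i => absz (z 0 i)) t -> dilate t (map_mx intr z).
Proof.
have [m] := ubnP #|A|; elim: m A t z => // m IH A t z Am zA leA.
have [A0|A0] := eqVneq A set0.
  exists 0; first exact: polytopeB0 i0.
  by apply/rowP => i; rewrite scaler0 !mxE zA // A0 inE.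
have [v vA deg_v] := forest_leaf_or_isolated e_sym e_irr e_forest A0.
have cA : (#|A :\ v| < m)%N by move: Am; rewrite (cardsD1 v) vA.
pose sg i := (-1) ^+ (z 0 i < 0)%R : R.
case: deg_v => [v_iso|[u [uA vu v_leaf]]].
  move: leA; rewrite (stable_le_isolated e_sym e_irr _ _ vA v_iso) => /andP[vt leA].
  pose z' : 'rV[int]_n := \row_i (if i == v then 0 else z 0 i).
  have -> : map_mx intr z = map_mx intr z' +
      (absz (z 0 v))%:R *: (sg v *: delta_mx 0 v) :> 'rV[R]_n.
    apply/rowP => i; rewrite !mxE eqxx /=; case: eqP => [->|_].
      by rewrite add0r mulr1 mulrC -intr_sign_absz.
    by rewrite !mulr0 addr0.
  rewrite -(subnK vt); apply: dilateD; last by apply/dilate_scale; apply: polytopeB_vertex.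
  apply: (IH _ _ _ cA) => [i|].
    by rewrite !inE negb_and negbK mxE => /orP[->//|/zA ->]; rewrite if_same.
  rewrite -(@eq_stable_le _ _ _ (fun i => absz (z 0 i))) // => i.
  by rewrite !inE mxE => /andP[/negPf->].
have uv : u != v by apply: contraTneq vu => ->; rewrite e_irr.
move: leA; rewrite (stable_le_leaf e_sym e_irr _ _ vA uA vu v_leaf) => /andP[vt leA].
pose a := absz (z 0 v); pose b := absz (z 0 u).
pose z' : 'rV[int]_n := \row_i
  (if i == v then 0 else if i == u then (-1) ^+ (z 0 u < 0)%R * (b - a)%N%:Z else z 0 i).
(* As much of [z_v] as possible is paired with [z_u] along the edge, the rest uses the vertex at
   [v]; this leaves [b - a], truncated, at [u]. *)
have -> : map_mx intr z = map_mx intr z' +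
    ((a - minn a b)%:R *: (sg v *: delta_mx 0 v) +
     (minn a b)%:R *: (sg v *: delta_mx 0 v + sg u *: delta_mx 0 u)) :> 'rV[R]_n.
  apply/rowP => i; rewrite !mxE eqxx /=; have [->|iv] := eqVneq i v.
    rewrite eq_sym (negPf uv) !mulr1 mulr0 addr0 add0r -mulrDl -natrD subnK ?geq_minl //.
    by rewrite mulrC -intr_sign_absz.
  have [->|iu] := eqVneq i u; last by rewrite !(mulr0, addr0).
  rewrite !(mulr0, add0r, mulr1) rmorphM rmorph_sign /=.
  rewrite [_ * sg u]mulrC -mulrDr -natrD intr_sign_absz.
  by rewrite (_ : _ + _ = b)%N // minnC; lia.
rewrite -(subnK vt); apply: dilateD.
  apply: (IH _ _ _ cA) => [i|].
    rewrite !inE negb_and negbK mxE => /orP[->//|iA]; rewrite (zA _ iA).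
    by case: (eqVneq i u) iA => [->|]; rewrite ?uA ?if_same.
  rewrite -(@eq_stable_le _ _ _ (clip (fun i => absz (z 0 i)) u v)) // => i.
  rewrite !inE mxE /clip => /andP[/negPf-> _]; case: eqP => // _.
  by rewrite abszMsign.
rewrite [X in dilate X _](_ : _ = (a - minn a b) + minn a b)%N; last by rewrite subnK ?geq_minl.
by apply: dilateD; apply: dilate_scale; [apply: polytopeB_vertex|apply: polytopeB_edge].
Qed.

Lemma ehrhart_polytopeB (i0 : 'I_n) (M t : nat) : (t <= M)%N ->
  ehrhart B t = stable_count M e setT t.
Proof.
move=> tM; pose toZ (x : {ffun 'I_n -> bounded_int M}) : 'rV[int]_n :=
  \row_i int_of_bounded (x i).
have toZ_inj : injective toZ.
  move=> x y /rowP xy; apply/ffunP => i; apply: int_of_bounded_inj.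
  by have := xy i; rewrite !mxE.
pose P := [pred x : {ffun 'I_n -> bounded_int M} |
             stable_le e setT (fun i => bounded_abs (x i)) t].
have PE (x : {ffun 'I_n -> bounded_int M}) :
    stable_le e setT (fun i => absz (toZ x 0 i)) t = P x.
  by apply: eq_stable_le => i _; rewrite mxE.
have latticeE : lattice_points B t = [set` [fset toZ x | x in P]%fset]%classic.
  apply/seteqP; split=> z /=.
    move=> /dilate_stable_le le_z.
    have bnd i : exists a : bounded_int M, int_of_bounded a = z 0 i.
      by apply/bounded_intP/(leq_trans _ tM)/(stable_le_point e_irr (in_setT i) le_z).
    pose x := [ffun i => projT1 (cid (bnd i))].
    have zx : z = toZ x by apply/rowP => i; rewrite mxE ffunE; case: cid.
    have Px : P x by rewrite -PE -zx.
    by rewrite zx; apply/imfsetP; exists x.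
  move=> /imfsetP[x /= xP ->]; apply: (stable_le_dilate i0 (A := setT)).
    by move=> i; rewrite inE.
  by rewrite PE.
rewrite /ehrhart latticeE set_fsetK card_imfset //= -cardE.
rewrite /stable_count /sum_on -sum1_card [LHS]big_mkcond [RHS]big_mkcond /=.
apply: eq_bigr => x _; rewrite [in RHS]ifT; last by apply/forallP => i; rewrite in_setT.
by rewrite [x \in P]inE /=; case: stable_le.
Qed.

Lemma dim_succ_polytopeB (i0 : 'I_n) : dim_succ B = n.+1.
Proof.
apply/eqP; rewrite eqn_leq; apply/andP; split.
  (* The maximum in [dim_succ] ranges over [k <= n.+1] only. *)
  by apply/bigmax_leqP => k _; rewrite -ltnS.
apply: (@leq_bigmax_cond _ _ _ (Ordinal (ltnSn n.+1))).
apply/asboolP.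
change (exists M : 'M[R]_(1 + n, n), (forall i, B (row i M)) /\
          row_free (row_mx (const_mx 1 : 'cV_(1 + n)) M)).
(* The origin and the unit vectors; with the column of ones prepended, the matrix is block lower
   triangular with determinant 1. *)
exists (col_mx 0 1%:M : 'M[R]_(1 + n, n)); split.
  move=> i; rewrite -(splitK i); case: (split i) => j /=.
    by rewrite rowKu row0; apply: polytopeB0 i0.
  by rewrite rowKd row1 -[delta_mx _ _]scale1r; apply: (polytopeB_vertex false).
have -> : (const_mx 1 : 'cV[R]_(1 + n)) = col_mx 1%:M (const_mx 1).
  apply/colP => i; rewrite mxE -(splitK i); case: (split i) => j /=.
    by rewrite col_mxEu ord1 mxE.
  by rewrite col_mxEd mxE.
by rewrite -block_mxEh row_free_unit unitmxE det_lblock !det1 mulr1 unitr1.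
Qed.

Lemma polytopeB_dim0 (p : 'rV[R]_n) : n = 0%N -> ~ B p.
Proof.
move=> n0 /(_ classical_sets.set0); apply; split; first by move=> x y l /set_mem.
have no_ord (i : 'I_n) : False by have := ltn_ord i; rewrite [X in (_ < X)%N]n0.
by move=> x [[_ [i _]]|[_ [_ [i _]]]]; case: (no_ord i).
Qed.

(* For [n = 0] the polytope is empty; the Ehrhart series is then 1 and the
   exponent [dim_succ] is 0. *)
Lemma hstar_polytopeB : hstar_poly B (matching_poly e setT).
Proof.
move=> m; have [n0|n_gt0] := posnP n.
  have -> : dim_succ B = 0%N.
    (* A matrix with at least one row would give a point of the empty polytope. *)
    apply/eqP; rewrite -leqn0; apply/bigmax_leqP => -[[|k] kn] //= /asboolP[N [BN _]].
    by case: (polytopeB_dim0 n0 (BN ord0)).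
  have ehrhart0 t : ehrhart B t = 0%N.
    rewrite /ehrhart (_ : lattice_points B t = classical_sets.set0) ?fset_set0 ?cardfs0 //.
    by apply/seteqP; split=> z //= [p /(polytopeB_dim0 n0)].
  have -> : [set: 'I_n] = set0 by apply/eqP; rewrite -cards_eq0 cardsT card_ord n0.
  rewrite matching_poly_set0 // big_ord_recl big1 => [|k _].
    by rewrite expr0 !coef1 subn0 addr0 mul1r; case: m => //= m; rewrite ehrhart0.
  by rewrite expr0 coef1 mul0r.
have i0 := Ordinal n_gt0.
rewrite -(stable_count_series e_sym e_irr e_forest setT (ltnSn m)) coefM.
rewrite cardsT card_ord (dim_succ_polytopeB i0); apply: eq_bigr => k _; congr (_ * _).
rewrite coef_trunc_series ?ltnS ?leq_subr // natz; congr Posz.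
(* At [t = 0] the series is 1 by convention, in agreement with [stable_count0]. *)
case: (m - k)%N (leq_subr k m) => [_|t tm]; first exact: stable_count0.
by rewrite /= (ehrhart_polytopeB i0 tm).
Qed.

End TypeBPolytope.

Theorem theorem7p5 (R : realType) (n : nat) (e : rel 'I_n)
    (e_sym : symmetric e) (e_irrefl : irreflexive e) (e_forest : forest e) :
  exists h g : {poly int},
    [/\ hstar_poly (polytopeB R e) h,
        gamma_poly n h g &
        exists (V : finType) (D : {set {set V}}),
          [/\ simplicial_complex D, flag D & g = f_poly D]].
Proof.
exists (matching_poly e setT), (f_poly (matching_complex e)); split.
- exact: hstar_polytopeB.
- by rewrite -[X in gamma_poly X]card_ord; apply: matching_poly_gamma.
exists (edge_copy e), (matching_complex e); split=> //.
  exact: matching_complex_simplicial.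
exact: matching_complex_flag.
Qed.
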